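(* For an integer $M\ge 1$ let $a_M$ be the maximum of $\psi(X)$ over all antipodal sets $X=-X\subset\mathbb{S}^2$ with $|X|=2M$. Let $X_M\subset\mathbb{S}^2$ be an antipodal set with $|X_M|=2M$ and $\psi(X_M)=a_M$. Then: 1. $X_2$ is the set of vertices of a square lying on a great circle (the equator, after a rotation of the sphere), and $a_2=90^\circ$; 2. $X_3$ is the set of vertices of a regular octahedron, and $a_3=90^\circ$; 3. $X_4$ is the set of vertices of a cube, and $a_4=\arccos(1/3)$; 4. $X_5$ is a set consisting of five pairs of antipodal vertices of a regular icosahedron, and $a_5=\arccos(1/\sqrt5)$; 5. $X_6$ is the set of vertices of a regular icosahedron, and $a_6=\arccos(1/\sqrt5)$.
   Context: $\mathbb{S}^2$ is the unit sphere in $\mathbb{R}^3$ and $\operatorname{dist}(x,y)$ is the angular (spherical) distance. For a finite set $X\subset\mathbb{S}^2$, $\psi(X):=\min\{\operatorname{dist}(x,y): x,y\in X,\ x\neq y\}$. A set $X\subset\mathbb{S}^2$ is antipodal if $X=-X$, i.e. $x\in X$ implies $-x\in X$. All polyhedra mentioned are inscribed in $\mathbb{S}^2$. *)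

(* Defs.v *)
From HB Require Import structures.
From mathcomp Require Import all_boot all_order all_algebra finmap.
From mathcomp Require Import boolp classical_sets reals trigo.

Set Implicit Arguments.
Unset Strict Implicit.
Unset Printing Implicit Defensive.

Import Order.TTheory GRing.Theory Num.Theory.

Local Open Scope fset_scope.
Local Open Scope ring_scope.

Section Defs.
Context {R : realType}.
Implicit Types (x y : 'rV[R]_3) (X Y : {fset 'rV[R]_3}) (M : nat).

Definition dot x y : R := \sum_(i < 3) x ord0 i * y ord0 i.

(* This is the angular distance only when x and y are on the unit sphere. *)
Definition dist x y : R := acos (dot x y).

Definition on_sphere X : Prop := forall x, x \in X -> dot x x = 1.

Definition antipodal X : Prop := forall x, x \in X -> - x \in X.

(* The default value pi bounds every angular distance, so it does not affect
   the minimum as soon as X has two distinct points. *)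
Definition psi X : R :=
  \big[Num.min/pi]_(x <- X) \big[Num.min/pi]_(y <- X | x != y) dist x y.

Definition antipodal_config M X : Prop :=
  [/\ on_sphere X, antipodal X & #|` X| = (2 * M)%N].

(* "a is the maximum of psi over the antipodal sets of 2M points": a is attained
   and is an upper bound. *)
Definition is_max_psi M (a : R) : Prop :=
  (exists2 X, antipodal_config M X & psi X = a) /\
  (forall Y, antipodal_config M Y -> psi Y <= a).

Definition optimal M X : Prop :=
  antipodal_config M X /\ is_max_psi M (psi X).

Definition vec3 (a b c : R) : 'rV[R]_3 := \row_(i < 3) [:: a; b; c]`_i.

Definition plus_minus (s : seq 'rV[R]_3) : {fset 'rV[R]_3} :=
  [fset x in s ++ [seq - x | x <- s]].

Definition rotation (Q : 'M[R]_3) : Prop := Q *m Q^T = 1%:M /\ \det Q = 1.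

Definition rotated_copy Y X : Prop :=
  exists2 Q : 'M[R]_3, rotation Q & X = [fset x *m Q | x in Y].

(* Any two squares inscribed in great circles, and any two regular polyhedra of
   the same type inscribed in the unit sphere, differ by a rotation; each shape
   is given by its usual coordinates, scaled to the unit sphere. *)
Definition equatorial_square : {fset 'rV[R]_3} :=
  plus_minus [:: vec3 1 0 0; vec3 0 1 0].

Definition std_octahedron : {fset 'rV[R]_3} :=
  plus_minus [:: vec3 1 0 0; vec3 0 1 0; vec3 0 0 1].

Definition std_cube : {fset 'rV[R]_3} :=
  plus_minus [seq (Num.sqrt 3)^-1 *: x |
    x <- [:: vec3 1 1 1; vec3 1 1 (-1); vec3 1 (-1) 1; vec3 (-1) 1 1]].

Definition golden : R := (1 + Num.sqrt 5) / 2.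

Definition std_icosahedron : {fset 'rV[R]_3} :=
  plus_minus [seq (Num.sqrt (1 + golden ^+ 2))^-1 *: x |
    x <- [:: vec3 0 1 golden; vec3 0 (-1) golden;
             vec3 golden 0 1; vec3 golden 0 (-1);
             vec3 1 golden 0; vec3 (-1) golden 0]].

Definition great_circle_square X : Prop := rotated_copy equatorial_square X.
Definition regular_octahedron X : Prop := rotated_copy std_octahedron X.
Definition cube X : Prop := rotated_copy std_cube X.
Definition regular_icosahedron X : Prop := rotated_copy std_icosahedron X.

Definition five_antipodal_pairs_of_icosahedron X : Prop :=
  exists2 Y, regular_icosahedron Y &
    [/\ X `<=` Y, antipodal X & #|` X| = 10%N].

End Defs.

(* Main.v *)
Require Import Defs.
From HB Require Import structures.
From mathcomp Require Import all_boot all_order all_algebra finmap.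
From mathcomp Require Import boolp classical_sets reals trigo.
From mathcomp Require Import ring lra.

Import Order.TTheory GRing.Theory Num.Theory.
Local Open Scope ring_scope.

(** Choosing one point per antipodal pair turns a configuration of 2M points
    into M unit vectors, and psi(X) >= arccos c means that any two of them have
    inner product at most c in absolute value ([configP]).  Each claim then
    reduces to rigidity ([optimal_of_rigid]): M unit vectors bounded in this
    way by the conjectured cosine c form the model configuration, up to an
    orthogonal map and changes of sign, and the bound c is attained.

    For c = 0 the vectors are orthonormal.  The other cases rest on a comparison
    of Gram matrices ([gram_rigid]).  Suppose that the vectors x_i satisfy two
    linear relations, with coefficients a_i and b_i, and let
    p_ij = a_i a_j + h b_i b_j with h >= 0.  The relations give
    sum p_ij <x_i, x_j> = 0, while sum p_ij <e_i, e_j> >= 0 for any vectors e_i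
    whatsoever.  If the e_i are unit vectors with <e_i, e_j> = -c where p_ij > 0
    and <e_i, e_j> = c where p_ij < 0, then every term of the first sum is at
    least the corresponding term of the second, so that all terms agree and the
    two Gram matrices coincide.  The comparison thus succeeds as soon as the
    signs of p_ij are those of a model attaining the bound.

    Since c < 1/2, any three of the vectors are independent
    ([three_independent]), and every linear relation among four of them has
    nonzero coefficients ([circuit]).
    - Four vectors: after changes of sign the coefficients of their relation
      are positive, so all p_ij > 0, and the model is a regular tetrahedron
      inscribed in the cube.
    - Five vectors: the relations form a plane, and the coefficients attached to
      the five vectors are five distinct lines in the dual plane.  Some
      Euclidean structure on that plane makes any two lines which are two steps
      apart in the cyclic order enclose, around the line between them, an angle
      below 90 degrees, as for five lines spaced by 36 degrees
      ([pentad_rigid]).  The signs of p_ij are then those required by five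
      diagonals of the icosahedron.
    - Six vectors: five of them are diagonals of an icosahedron by the previous
      case.  As the six diagonals form a tight frame, a sixth vector satisfying
      the bounds has to lie on the remaining diagonal ([apex_rigid]).

    Equal Gram matrices of spanning families give an orthogonal map between
    them ([congruent_orthogonal]); composing it with -1 if necessary makes it a
    rotation ([orthogonal_copy]). *)

Set Implicit Arguments.
Unset Strict Implicit.

(** * The inner product *)

Section Dot.
Context {R : realType}.
Implicit Types (x y z v : 'rV[R]_3) (a b k c : R) (s : seq 'rV[R]_3).

Lemma dot_mulmx x y : dot x y = (x *m y^T) 0 0.
Proof. by rewrite mxE; apply: eq_bigr => i _; rewrite !mxE. Qed.

Lemma dotC x y : dot x y = dot y x.
Proof. by apply: eq_bigr => i _; rewrite mulrC. Qed.

Lemma dotDl x y z : dot (x + y) z = dot x z + dot y z.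
Proof. by rewrite !dot_mulmx mulmxDl mxE. Qed.

Lemma dotDr z x y : dot z (x + y) = dot z x + dot z y.
Proof. by rewrite dotC dotDl !(dotC z). Qed.

Lemma dotZl a x y : dot (a *: x) y = a * dot x y.
Proof. by rewrite !dot_mulmx -scalemxAl mxE. Qed.

Lemma dotZr a x y : dot x (a *: y) = a * dot x y.
Proof. by rewrite dotC dotZl dotC. Qed.

Lemma dotNl x y : dot (- x) y = - dot x y.
Proof. by rewrite -scaleN1r dotZl mulN1r. Qed.

Lemma dotNr x y : dot x (- y) = - dot x y.
Proof. by rewrite dotC dotNl dotC. Qed.

Lemma dot0l x : dot 0 x = 0.
Proof. by rewrite -(scale0r 0) dotZl mul0r. Qed.

Lemma dot0r x : dot x 0 = 0.
Proof. by rewrite dotC dot0l. Qed.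

Lemma dotxx_ge0 x : 0 <= dot x x.
Proof. by apply: sumr_ge0 => i _; rewrite -expr2 sqr_ge0. Qed.

Lemma dotxx_eq0 x : dot x x = 0 -> x = 0.
Proof.
move=> /eqP; rewrite psumr_eq0 => [/allP x0|i _]; last by rewrite -expr2 sqr_ge0.
apply/rowP => i; rewrite mxE; apply/eqP.
by have := x0 i; rewrite mem_index_enum mulf_eq0 orbb; apply.
Qed.

Lemma dot_suml n (F : 'I_n -> 'rV[R]_3) y :
  dot (\sum_i F i) y = \sum_i dot (F i) y.
Proof.
by apply: (big_morph (fun v => dot v y)) => [u v|]; rewrite ?dotDl ?dot0l.
Qed.

Lemma dot_sumr n (F : 'I_n -> 'rV[R]_3) y :
  dot y (\sum_i F i) = \sum_i dot y (F i).
Proof. by rewrite dotC dot_suml; apply: eq_bigr => i _; rewrite dotC. Qed.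

Definition dotE := (dotDl, dotDr, dotNl, dotNr, dotZl, dotZr, dot0l, dot0r).

Lemma dot_vec3 a b c a' b' c' :
  dot (vec3 a b c) (vec3 a' b' c') = a * a' + b * b' + c * c'.
Proof. by rewrite /dot !big_ord_recl big_ord0 !mxE /= addr0 addrA. Qed.

(** Two unit vectors with inner product 1 are at Euclidean distance 0. *)
Lemma unit_eq x y : dot x x = 1 -> dot y y = 1 -> 1 <= dot x y -> x = y.
Proof.
move=> x1 y1 xy; apply/eqP; rewrite -subr_eq0; apply/eqP/dotxx_eq0.
apply/le_anti; rewrite dotxx_ge0 andbT !dotE x1 y1 (dotC y x); lra.
Qed.

Lemma dot_unit_itv x y : dot x x = 1 -> dot y y = 1 -> -1 <= dot x y <= 1.
Proof.
move=> x1 y1; have := dotxx_ge0 (x + y); have := dotxx_ge0 (x - y).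
by rewrite !dotE x1 y1 (dotC y x) => *; lra.
Qed.

Lemma unit_neqN x : dot x x = 1 -> x != - x.
Proof.
move=> x1; apply/eqP => xN; have : dot x x = - dot x x by rewrite {1}xN dotNl.
rewrite x1; lra.
Qed.

(** A 3 by 3 Gram matrix with unit diagonal whose other entries are below 1/2
    in absolute value is strictly diagonally dominant. *)
Lemma three_independent c x y z a b k : c < 1 / 2 ->
  dot x x = 1 -> dot y y = 1 -> dot z z = 1 ->
  `|dot x y| <= c -> `|dot x z| <= c -> `|dot y z| <= c ->
  a *: x + b *: y + k *: z = 0 -> [/\ a = 0, b = 0 & k = 0].
Proof.
move=> c2 x1 y1 z1 xy xz yz s0.
have cross p q g : `|g| <= c -> - (c * (p ^+ 2 + q ^+ 2)) <= 2 * (p * q * g).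
  rewrite ler_norml => /andP[gl gu].
  have := mulr_ge0 (sqr_ge0 (p + q)) (_ : 0 <= c + g).
  have := mulr_ge0 (sqr_ge0 (p - q)) (_ : 0 <= c - g).
  move=> /(_ ltac:(lra)) h1 /(_ ltac:(lra)) h2; nra.
have := cross a b _ xy; have := cross a k _ xz; have := cross b k _ yz.
have : dot (a *: x + b *: y + k *: z) (a *: x + b *: y + k *: z) = 0.
  by rewrite s0 dot0l.
rewrite !dotE x1 y1 z1 (dotC y x) (dotC z x) (dotC z y) => e h1 h2 h3.
have d : 0 < 1 - 2 * c by lra.
have s : (1 - 2 * c) * (a ^+ 2 + b ^+ 2 + k ^+ 2) <= 0 by nra.
have {}s : a ^+ 2 + b ^+ 2 + k ^+ 2 <= 0 by rewrite pmulr_rle0 in s.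
have := sqr_ge0 a; have := sqr_ge0 b; have := sqr_ge0 k => *.
by split; apply/eqP; rewrite -sqrf_eq0; apply/eqP; lra.
Qed.

End Dot.

(** * Antipodal sets and one representative per pair *)

Section Configurations.
Context {R : realType}.
Implicit Types (x y v : 'rV[R]_3) (a c : R) (s : seq 'rV[R]_3).
Implicit Types (X Y : {fset 'rV[R]_3}) (M : nat).

Lemma mem_plus_minus s v : (v \in plus_minus s) = (v \in s) || (- v \in s).
Proof.
rewrite !inE; congr (_ || _).
by apply/mapP/idP => [[x xs ->]|vs]; [rewrite opprK | exists (- v); rewrite ?opprK].
Qed.

Lemma antipodal_plus_minus s : antipodal (plus_minus s).
Proof. by move=> x; rewrite !mem_plus_minus opprK orbC. Qed.

Lemma eq_plus_minus s s' : s =i s' -> plus_minus s = plus_minus s'.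
Proof. by move=> e; apply/fsetP => v; rewrite !mem_plus_minus !e. Qed.

Lemma plus_minus_flip x y s s' : x = y \/ x = - y ->
  plus_minus s = plus_minus s' -> plus_minus (x :: s) = plus_minus (y :: s').
Proof.
move=> xy ss'; apply/fsetP => v; rewrite !mem_plus_minus !inE.
have := congr1 (fun A : {fset _} => v \in A) ss'; rewrite !mem_plus_minus => h.
have : (v == x) || (- v == x) = (v == y) || (- v == y).
  by case: xy => -> //; rewrite eqr_opp eqr_oppLR orbC.
by rewrite orbACA => ->; rewrite h orbACA.
Qed.

Lemma plus_minus_mulmx s (Q : 'M[R]_3) :
  plus_minus [seq x *m Q | x <- s] = [fset x *m Q | x in plus_minus s]%fset.
Proof.
apply/fsetP => v; rewrite mem_plus_minus; apply/idP/imfsetP => /=.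
  case/orP => /mapP[x xs vx]; [exists x => // | exists (- x)];
  by rewrite ?mem_plus_minus ?opprK ?xs ?orbT // mulNmx -vx opprK.
case=> x + ->; rewrite mem_plus_minus => /orP[] xs; apply/orP; [left|right].
  by apply/mapP; exists x.
by apply/mapP; exists (- x); rewrite ?mulNmx.
Qed.

Definition all_unit s := all (fun x => dot x x == 1) s.

(** For unit vectors: the lines which they span make pairwise angles of at least
    arccos c. *)
Definition coherence_le c s := pairwise (fun x y => `|dot x y| <= c) s.

Lemma plus_minus_config c s : 0 <= c < 1 -> all_unit s -> coherence_le c s ->
  antipodal_config (size s) (plus_minus s) /\
  (forall x y, x \in plus_minus s -> y \in plus_minus s -> x != y ->
     dot x y <= c).
Proof.
move=> /andP[c0 c1] /allP su sc; have su' x : x \in s -> dot x x = 1 by move/su/eqP.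
have us : uniq s.
  rewrite uniq_pairwise; apply: (sub_in_pairwise _ (allss s) sc) => x y xs ys /=.
  by apply: contraTneq => <-; rewrite su' // normr1 -ltNge.
have scN x y : x \in s -> y \in s -> x != y -> `|dot x y| <= c.
  move=> xs ys xy; move/(pairwiseP 0): sc => sc.
  have [ix iy] : (index x s < size s)%N /\ (index y s < size s)%N.
    by rewrite !index_mem.
  have [lt|lt|eq] := ltngtP (index x s) (index y s).
  - by have := sc _ _ ix iy lt; rewrite !nth_index.
  - by have := sc _ _ iy ix lt; rewrite !nth_index // dotC.
  - by rewrite -(nth_index 0 xs) -(nth_index 0 ys) eq eqxx in xy.
have sN x : x \in s -> - x \notin s.
  move=> xs; apply/negP => Nxs; have := scN _ _ xs Nxs (unit_neqN (su' _ xs)).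
  by rewrite dotNr su' // normrN normr1; lra.
split; last first.
  move=> x y; rewrite !mem_plus_minus => xs ys xy.
  case: (eqVneq x (- y)) => [xNy|xNy].
    rewrite xNy dotNl.
    have y1 : dot y y = 1.
      by case/orP: ys => /su' //; rewrite dotNl dotNr opprK.
    by rewrite y1; lra.
  apply: (le_trans (ler_norm _)).
  case/orP: xs => xs; case/orP: ys => ys.
  - exact: scN.
  - by rewrite -(opprK y) dotNr normrN; apply: scN => //; rewrite eqr_oppRL opprK.
  - by rewrite -(opprK x) dotNl normrN; apply: scN => //; rewrite eqr_oppLR.
  - by rewrite -(opprK x) -(opprK y) dotNl dotNr opprK; apply: scN; rewrite // eqr_opp.
split.
- move=> x; rewrite mem_plus_minus => /orP[] /su' //.
  by rewrite dotNl dotNr opprK.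
- exact: antipodal_plus_minus.
- rewrite /plus_minus card_fseq undup_id ?size_cat ?size_map ?mul2n ?addnn //.
  rewrite cat_uniq us map_inj_uniq ?us ?andbT; last exact: oppr_inj.
  by apply/hasPn => x /mapP[z zs ->]; apply: sN.
Qed.

(** Representatives are obtained by removing one antipodal pair at a time; the
    absolute value in [coherence_le] accounts for both points of a pair. *)
Lemma configP c M X : c < 1 -> antipodal_config M X ->
  (forall x y, x \in X -> y \in X -> x != y -> dot x y <= c) ->
  exists s, [/\ size s = M, X = plus_minus s, all_unit s & coherence_le c s].
Proof.
move=> c1; elim: M X => [|M IH] X [sX aX cX] dX.
  exists [::]; split => //; move/eqP: cX; rewrite cardfs_eq0 => /eqP ->.
  by apply/fsetP => v; rewrite mem_plus_minus !inE.
have /fset0Pn[x xX] : X != fset0 by rewrite -cardfs_gt0 cX.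
have xNx := unit_neqN (sX _ xX).
pose Y := (X `\ x `\ - x)%fset.
have YX y : y \in Y -> [/\ y \in X, y != x & y != - x].
  by rewrite !inE => /and3P[].
have cY : antipodal_config M Y.
  split=> [y /YX[yX _ _]|y|]; first exact: sX.
    by rewrite !inE => /and3P[yx yNx yX]; rewrite eqr_opp yNx eqr_oppLR yx aX.
  have := cX; rewrite (cardfsD1 x) xX (cardfsD1 (- x)) !inE eq_sym xNx aX //.
  by rewrite mulnS !add1n => -[->].
have [|s [ss YE us cs]] := IH _ cY.
  by move=> y z /YX[yX _ _] /YX[zX _ _]; apply: dX.
exists (x :: s); split=> /=; rewrite ?ss //.
- apply/fsetP => v; rewrite mem_plus_minus !inE orbACA -mem_plus_minus -YE !inE.
  rewrite eqr_oppLR; case: (eqVneq v x) => [->|_]; first by rewrite xX.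
  by case: eqVneq => [->|_] //=; rewrite aX.
- by rewrite sX ?eqxx.
- rewrite cs andbT; apply/allP => y ys; rewrite ler_norml.
  have /YX[yX yx yNx] : y \in Y by rewrite YE mem_plus_minus ys.
  rewrite lerNl -dotNr !dX ?aX // eq_sym ?yx // eqr_oppLR //.
Qed.

Lemma acos_le (u v : R) : -1 <= u <= 1 -> -1 <= v <= 1 ->
  (acos u <= acos v) = (v <= u).
Proof.
move=> u1 v1; rewrite !leNgt -ltr_cos ?acosK ?in_itv //=.
all: by rewrite acos_ge0 // acos_lepi.
Qed.

Lemma psi_le X x y : x \in X -> y \in X -> x != y -> psi X <= dist x y.
Proof.
move=> xX yX xy; rewrite /psi; apply: (@bigmin_inf_seq _ _ _ _ _ x) => //.
exact: (@bigmin_inf_seq _ _ _ _ _ y).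
Qed.

Lemma psi_ge X a : a <= pi ->
  (forall x y, x \in X -> y \in X -> x != y -> a <= dist x y) -> a <= psi X.
Proof.
move=> api aX; rewrite /psi big_seq; apply: le_bigmin => // x xX.
rewrite big_seq_cond; apply: le_bigmin => // y /andP[yX xy].
exact: aX.
Qed.

(** The optimization problem is settled by a rigidity statement: if the
    configurations with all inner products at most c have the required shape
    and attain the value c, then no configuration can do better than arccos c,
    and the optimal ones are among them. *)
Lemma optimal_of_rigid M c (shape : {fset 'rV[R]_3} -> Prop) s0 :
    0 <= c < 1 -> size s0 = M -> all_unit s0 -> coherence_le c s0 ->
    (forall s, size s = M -> all_unit s -> coherence_le c s ->
       shape (plus_minus s) /\
       exists x y, [/\ x \in plus_minus s, y \in plus_minus s, x != y &
                       c <= dot x y]) ->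
  (forall X, optimal M X -> shape X) /\ is_max_psi M (acos c).
Proof.
move=> c01 <- u0 coh0 rigid; have /andP[c0 c1] := c01.
have c11 : -1 <= c <= 1 by lra.
have [conf0 dot0] := plus_minus_config c01 u0 coh0.
have psi0 : acos c <= psi (plus_minus s0).
  apply: psi_ge => [|x y xX yX xy]; first exact: acos_lepi.
  case: conf0 => sX _ _.
  by rewrite acos_le ?dot_unit_itv ?sX // dot0.
have close X : antipodal_config (size s0) X -> acos c <= psi X ->
    forall x y, x \in X -> y \in X -> x != y -> dot x y <= c.
  move=> [sX _ _] le x y xX yX xy; have := le_trans le (psi_le xX yX xy).
  by rewrite acos_le ?dot_unit_itv ?sX.
have max X : antipodal_config (size s0) X -> psi X <= acos c.
  move=> cX; rewrite leNgt; apply/negP => lt.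
  have [s [ss XE us cs]] := configP c1 cX (close _ cX (ltW lt)).
  have [_ [x [y [xX yX xy cxy]]]] := rigid _ ss us cs.
  rewrite -XE in xX yX; have [sX _ _] := cX.
  have := lt_le_trans lt (psi_le xX yX xy).
  by rewrite ltNge acos_le ?dot_unit_itv ?sX // cxy.
split=> [X [cX [_ mX]]|].
  have [|s [ss -> us cs]] := configP c1 cX (close _ cX _).
    exact: le_trans (mX _ conf0).
  by have [] := rigid _ ss us cs.
split=> //; exists (plus_minus s0) => //; apply/le_anti/andP; split => //.
exact: max.
Qed.

End Configurations.

(** * Linear relations, Gram matrices and rotations *)

Section Rigidity.
Context {R : realType}.
Implicit Types (x y z v : 'rV[R]_3) (c : R) (s : seq 'rV[R]_3).

Lemma dependent4 x1 x2 x3 x4 : exists b1 b2 b3 b4 : R,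
  ~~ [&& b1 == 0, b2 == 0, b3 == 0 & b4 == 0] /\
  b1 *: x1 + b2 *: x2 + b3 *: x3 + b4 *: x4 = 0.
Proof.
pose A := \matrix_(i < 4) [:: x1; x2; x3; x4]`_i.
have /rowV0Pn[b /sub_kermxP bA b0] : kermx A != 0.
  by rewrite -mxrank_eq0 mxrank_ker -lt0n subn_gt0 (leq_ltn_trans (rank_leq_col A)).
exists (b 0 0), (b 0 1), (b 0 2), (b 0 3); split.
  apply: contra b0 => /and4P[/eqP b00 /eqP b01 /eqP b02 /eqP b03].
  apply/eqP/rowP => -[[|[|[|[|//]]]] lt]; rewrite mxE.
  - by rewrite -[RHS]b00; congr (b _ _); apply: val_inj.
  - by rewrite -[RHS]b01; congr (b _ _); apply: val_inj.
  - by rewrite -[RHS]b02; congr (b _ _); apply: val_inj.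
  - by rewrite -[RHS]b03; congr (b _ _); apply: val_inj.
rewrite -[RHS]bA mulmx_sum_row !big_ord_recl big_ord0 !rowK /= addr0 !addrA.
by congr (b _ _ *: _ + b _ _ *: _ + b _ _ *: _ + b _ _ *: _); apply: val_inj.
Qed.

(** A vanishing coefficient would leave a relation between three vectors. *)
Lemma circuit c x1 x2 x3 x4 : c < 1 / 2 ->
  all_unit [:: x1; x2; x3; x4] -> coherence_le c [:: x1; x2; x3; x4] ->
  exists b1 b2 b3 b4, [/\ b1 != 0, b2 != 0, b3 != 0 & b4 != 0] /\
    b1 *: x1 + b2 *: x2 + b3 *: x3 + b4 *: x4 = 0.
Proof.
move=> c2 /and5P[/eqP u1 /eqP u2 /eqP u3 /eqP u4 _].
rewrite /coherence_le /= !andbT => /and3P[/and3P[c12 c13 c14] /andP[c23 c24] c34].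
have [b1 [b2 [b3 [b4 [bn0 b0]]]]] := dependent4 x1 x2 x3 x4.
exists b1, b2, b3, b4; split => //.
have indep := three_independent c2.
split; apply: contra bn0 => /eqP bz; move: b0; rewrite bz scale0r ?add0r ?addr0.
- by case/(indep _ _ _ _ _ _ u2 u3 u4) => // -> -> ->; rewrite !eqxx.
- by case/(indep _ _ _ _ _ _ u1 u3 u4) => // -> -> ->; rewrite !eqxx.
- by case/(indep _ _ _ _ _ _ u1 u2 u4) => // -> -> ->; rewrite !eqxx.
- by case/(indep _ _ _ _ _ _ u1 u2 u3) => // -> -> ->; rewrite !eqxx.
Qed.

Lemma decompose c x y1 y2 y3 : c < 1 / 2 ->
  all_unit [:: y1; y2; y3] -> coherence_le c [:: y1; y2; y3] ->
  exists a1 a2 a3, x = a1 *: y1 + a2 *: y2 + a3 *: y3.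
Proof.
move=> c2 /and4P[/eqP u1 /eqP u2 /eqP u3 _].
rewrite /coherence_le /= !andbT => /andP[/andP[c12 c13] c23].
have [b0 [b1 [b2 [b3 [bn0 b0E]]]]] := dependent4 x y1 y2 y3.
have bx0 : b0 != 0.
  apply: contra bn0 => /eqP bz; move: b0E; rewrite bz scale0r add0r.
  by case/(three_independent c2 u1 u2 u3) => // -> -> ->; rewrite !eqxx.
exists (- (b0^-1 * b1)), (- (b0^-1 * b2)), (- (b0^-1 * b3)).
move/(congr1 ( *:%R b0^-1)): b0E.
rewrite scaler0 !scalerDr !scalerA mulVf // scale1r -!addrA => /eqP.
by rewrite addr_eq0 => /eqP ->; rewrite !scaleNr -!opprD.
Qed.

Lemma spanning3 c v y1 y2 y3 : c < 1 / 2 ->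
  all_unit [:: y1; y2; y3] -> coherence_le c [:: y1; y2; y3] ->
  dot v y1 = 0 -> dot v y2 = 0 -> dot v y3 = 0 -> v = 0.
Proof.
move=> c2 u coh v1 v2 v3; apply: dotxx_eq0.
have [a1 [a2 [a3 vE]]] := decompose v c2 u coh.
by rewrite {2}vE !dotE v1 v2 v3 !mulr0 !addr0.
Qed.

(** With p_ij = a_i a_j + h b_i b_j, the sum of p_ij <y_i, y_j> is
    |sum a_i y_i|^2 + h |sum b_i y_i|^2: it vanishes for x and is nonnegative
    for e, whereas the sign hypothesis makes each of its terms at least as large
    for x as for e.  All terms therefore agree. *)
Lemma gram_rigid n c (x e : 'I_n -> 'rV[R]_3) (a b : 'I_n -> R) h : 0 <= h ->
  (forall i, dot (x i) (x i) = dot (e i) (e i)) ->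
  (forall i j : 'I_n, (i < j)%N -> `|dot (x i) (x j)| <= c) ->
  \sum_i a i *: x i = 0 -> \sum_i b i *: x i = 0 ->
  (forall i j : 'I_n, (i < j)%N ->
     (0 < a i * a j + h * (b i * b j) /\ dot (e i) (e j) = - c) \/
     (a i * a j + h * (b i * b j) < 0 /\ dot (e i) (e j) = c)) ->
  forall i j, dot (x i) (x j) = dot (e i) (e j).
Proof.
move=> h0 xe xc sa sb sgn.
pose p i j := a i * a j + h * (b i * b j).
have quad (y : 'I_n -> 'rV[R]_3) : \sum_i \sum_j p i j * dot (y i) (y j) =
    dot (\sum_i a i *: y i) (\sum_i a i *: y i) +
    h * dot (\sum_i b i *: y i) (\sum_i b i *: y i).
  rewrite !dot_suml mulr_sumr -big_split /=; apply: eq_bigr => i _.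
  rewrite !dot_sumr mulr_sumr -big_split /=; apply: eq_bigr => j _.
  by rewrite !dotE /p; ring.
pose d i j := p i j * (dot (x i) (x j) - dot (e i) (e j)).
have dC i j : d i j = d j i.
  by rewrite /d /p (dotC (x i)) (dotC (e i)) (mulrC (a i)) (mulrC (b i)).
have d_ge0 i j : 0 <= d i j.
  wlog ij : i j / (i < j)%N.
    move=> W; case: (ltngtP i j) => [/W // | /W | /val_inj ->]; first by rewrite dC.
    by rewrite /d xe subrr mulr0.
  have := xc _ _ ij; rewrite ler_norml /d => /andP[lo up].
  have [[pp ->] | [pn ->]] := sgn _ _ ij.
    by apply: mulr_ge0; [exact: ltW | rewrite opprK addrC -lerBlDl sub0r].
  by apply: mulr_le0; [exact: ltW | rewrite subr_le0].
have sum_d : \sum_i \sum_j d i j = 0.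
  apply/le_anti/andP; split; last by do 2! apply: sumr_ge0 => ? _.
  have -> : \sum_i \sum_j d i j = \sum_i \sum_j p i j * dot (x i) (x j) -
                                  \sum_i \sum_j p i j * dot (e i) (e j).
    rewrite -sumrB; apply: eq_bigr => i _; rewrite -sumrB.
    by apply: eq_bigr => j _; rewrite /d mulrBr.
  rewrite !quad sa sb !dot0l mulr0 add0r sub0r oppr_le0.
  by rewrite addr_ge0 ?mulr_ge0 ?dotxx_ge0.
have d0 i j : d i j = 0.
  move/eqP: sum_d; rewrite psumr_eq0 => [/allP/(_ i)|k _]; last exact: sumr_ge0.
  rewrite mem_index_enum => /(_ isT)/=.
  by rewrite psumr_eq0 // => /allP/(_ j); rewrite mem_index_enum => /(_ isT)/eqP.
move=> i j; wlog ij : i j / (i < j)%N.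
  move=> W; case: (ltngtP i j) => [/W // | /W | /val_inj -> //].
  by rewrite dotC (dotC (e j)).
have /eqP := d0 i j; rewrite mulf_eq0 subr_eq0 => /orP[/eqP p0|/eqP //].
by case: (sgn _ _ ij); rewrite -/(p i j) p0 ltxx => -[].
Qed.

(** Writing the two families as the rows of X and E, the map is Q = L X for a
    left inverse L of E; equality of the Gram matrices makes Q orthogonal and
    X - E Q of norm 0. *)
Lemma congruent_orthogonal n (x e : 'I_n -> 'rV[R]_3) :
  (forall i j, dot (x i) (x j) = dot (e i) (e j)) ->
  (forall v, (forall i, dot v (e i) = 0) -> v = 0) ->
  exists Q : 'M[R]_3, Q *m Q^T = 1%:M /\ forall i, x i = e i *m Q.
Proof.
move=> xe span.
pose X := \matrix_(i < n) x i; pose E := \matrix_(i < n) e i.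
have XE : X *m X^T = E *m E^T.
  apply/matrixP => i j; rewrite !mxE; have := xe i j; rewrite /dot => xeij.
  by under eq_bigr do rewrite !mxE; rewrite xeij; apply: eq_bigr => k _; rewrite !mxE.
have /row_fullP[L LE] : row_full E.
  rewrite /row_full -mxrank_tr; apply: inj_row_free => v vE; apply: span => i.
  rewrite dot_mulmx; have /matrixP/(_ 0 i) := vE; rewrite !mxE => vEi.
  by rewrite -[RHS]vEi; apply: eq_bigr => k _; rewrite !mxE.
have LE' : E^T *m L^T = 1%:M by rewrite -trmx_mul LE trmx1.
exists (L *m X); split.
  by rewrite trmx_mul mulmxA -(mulmxA L) XE mulmxA LE mul1mx.
move=> i; apply/eqP; rewrite -subr_eq0; apply/eqP/dotxx_eq0.
pose D := X - E *m (L *m X).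
have DX : D *m X^T = 0.
  by rewrite mulmxBl -!mulmxA XE (mulmxA L) LE mul1mx subrr.
have DD : D *m D^T = 0.
  by rewrite {2}/D linearB /= !trmx_mul mulmxBr !mulmxA DX !mul0mx subrr.
have -> : x i - e i *m (L *m X) = row i D by rewrite linearB /= row_mul !rowK.
have /matrixP/(_ i i) := DD; rewrite !mxE => DDi; rewrite -[RHS]DDi.
by apply: eq_bigr => k _; rewrite ![_^T _ _]mxE ![row _ _ _ _]mxE.
Qed.

(** The sign of the determinant is adjusted by the antipodal map, which fixes
    every antipodal set. *)
Lemma orthogonal_copy s (Q : 'M[R]_3) : Q *m Q^T = 1%:M ->
  rotated_copy (plus_minus s) (plus_minus [seq v *m Q | v <- s]).
Proof.
move=> QQ; have : \det Q ^+ 2 = 1.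
  by rewrite expr2 -{2}det_tr -det_mulmx QQ det1.
move/eqP; rewrite sqrf_eq1 => /orP[] /eqP dQ.
  by exists Q; rewrite ?plus_minus_mulmx.
exists (- Q).
  split; first by rewrite linearN /= mulNmx mulmxN opprK.
  by rewrite -scaleN1r detZ dQ exprS sqrrN expr1n mulr1 mulrNN mulr1.
rewrite -plus_minus_mulmx; elim: s => //= v s IH.
by apply: plus_minus_flip IH; right; rewrite mulmxN opprK.
Qed.

End Rigidity.

Section Shapes.
Context {R : realType}.
Implicit Types (x y z v : 'rV[R]_3) (c : R) (s e : seq 'rV[R]_3).

Lemma congruent_lists n s e : size s = n -> size e = n ->
  (forall i j : 'I_n, dot s`_i s`_j = dot e`_i e`_j) ->
  (forall v, (forall w, w \in e -> dot v w = 0) -> v = 0) ->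
  exists2 Q : 'M[R]_3, Q *m Q^T = 1%:M & s = [seq v *m Q | v <- e].
Proof.
move=> sn en gram span.
have [|Q [QQ xQ]] := congruent_orthogonal (x := fun i : 'I_n => s`_i) gram.
  move=> v ve; apply: span => w we.
  have lt : (index w e < n)%N by rewrite -en index_mem.
  by have := ve (Ordinal lt); rewrite /= nth_index.
exists Q => //; apply: (@eq_from_nth _ 0); rewrite ?size_map ?sn ?en // => i lt.
by rewrite (nth_map 0) ?en //; have := xQ (Ordinal lt).
Qed.

Lemma spanning_prefix c e v : c < 1 / 2 -> all_unit e -> coherence_le c e ->
  (2 < size e)%N -> (forall w, w \in e -> dot v w = 0) -> v = 0.
Proof.
case: e => [|x [|y [|z e]]] // c2 ue ce _ ve.
apply: (spanning3 (y1 := x) (y2 := y) (y3 := z) c2).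
- by move: ue => /and4P[u1 u2 u3 _]; apply/and4P.
- exact: (subseq_pairwise (prefix_subseq [:: x; y; z] e)).
- by apply: ve; rewrite inE eqxx.
- by apply: ve; rewrite !inE eqxx !orbT.
- by apply: ve; rewrite !inE eqxx !orbT.
Qed.

Lemma vec3N (a b k : R) : - vec3 a b k = vec3 (- a) (- b) (- k).
Proof. by apply/rowP => -[[|[|[|//]]] ?]; rewrite !mxE. Qed.

Lemma normr_le0_eq0 (a : R) : `|a| <= 0 -> a = 0.
Proof. by rewrite normr_le0 => /eqP. Qed.

(** * Orthogonal pairs and triples *)

Definition axes : seq 'rV[R]_3 := [:: vec3 1 0 0; vec3 0 1 0; vec3 0 0 1].

Lemma axes_unit : all_unit axes.
Proof.
by rewrite /all_unit /= !dot_vec3 !(mulr0, mul0r, mulr1, addr0, add0r) eqxx.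
Qed.

Lemma axes_coherence : coherence_le 0 axes.
Proof.
rewrite /coherence_le /= !dot_vec3.
by rewrite !(mulr0, mul0r, mulr1, addr0, add0r) normr0 lexx.
Qed.

Lemma orthonormal_axes x y z : dot x x = 1 -> dot y y = 1 -> dot z z = 1 ->
  dot x y = 0 -> dot x z = 0 -> dot y z = 0 ->
  exists2 Q : 'M[R]_3, Q *m Q^T = 1%:M & [:: x; y; z] = [seq v *m Q | v <- axes].
Proof.
move=> x1 y1 z1 xy xz yz; apply: (@congruent_lists 3) => //.
  rewrite /axes => -[[|[|[|//]]] ?] -[[|[|[|//]]] ?] /=;
    rewrite dot_vec3 ?(dotC y x) ?(dotC z) ?x1 ?y1 ?z1 ?xy ?xz ?yz; ring.
move=> v; apply: spanning_prefix axes_unit axes_coherence _ => //.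
by rewrite divr_gt0.
Qed.

Lemma unit_orthogonal x y : exists v, [/\ dot v v = 1, dot x v = 0 & dot y v = 0].
Proof.
pose A := \matrix_(i < 2) [:: x; y]`_i.
have /rowV0Pn[v /sub_kermxP vA v0] : kermx A^T != 0.
  by rewrite -mxrank_eq0 mxrank_ker -lt0n subn_gt0 (leq_ltn_trans (rank_leq_col _)).
have dot_row i : dot v (row i A) = 0.
  have /matrixP/(_ 0 i) := vA; rewrite !mxE => vAi; rewrite -[RHS]vAi.
  by apply: eq_bigr => k _; rewrite !mxE.
have := dot_row 0; have := dot_row 1; rewrite !rowK /= => vy vx.
have vv : 0 < dot v v.
  rewrite lt_neqAle dotxx_ge0 andbT eq_sym; apply: contra v0 => /eqP.
  by move/dotxx_eq0 ->.
exists ((Num.sqrt (dot v v))^-1 *: v).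
rewrite !dotE (dotC x) (dotC y) vx vy !mulr0; split => //.
have s0 : Num.sqrt (dot v v) != 0 by rewrite sqrtr_eq0 -ltNge.
by rewrite -{3}(sqr_sqrtr (ltW vv)); field.
Qed.

(** Negating one of the two points produces a pair of the antipodal set at
    distance exactly arccos c. *)
Lemma sharp_pair c s x y : c < 1 -> x \in s -> y \in s -> dot x x = 1 ->
  `|dot x y| = c -> exists x y,
    [/\ x \in plus_minus s, y \in plus_minus s, x != y & c <= dot x y].
Proof.
move=> c1 xs ys x1 xy.
have [z zs xz] : exists2 z, z \in plus_minus s & dot x z = c.
  case: (lerP 0 (dot x y)) => [ge0|lt0].
    by exists y; rewrite ?mem_plus_minus ?ys // -xy ger0_norm.
  by exists (- y); rewrite ?mem_plus_minus ?opprK ?ys ?orbT // dotNr -xy ltr0_norm.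
exists x, z; split; rewrite ?xz //; first by rewrite mem_plus_minus xs.
by apply: contraTneq c1 => zx; rewrite -xz -zx x1 ltxx.
Qed.

Lemma two_rigid s : size s = 2 -> all_unit s -> coherence_le 0 s ->
  great_circle_square (plus_minus s) /\ exists x y,
    [/\ x \in plus_minus s, y \in plus_minus s, x != y & 0 <= dot x y].
Proof.
case: s => [|x [|y [|]]] // _ /and3P[/eqP x1 /eqP y1 _].
rewrite /coherence_le /= !andbT => /normr_le0_eq0 xy.
have [z [z1 xz yz]] := unit_orthogonal x y.
split; last first.
  by apply: (@sharp_pair _ _ x y); rewrite ?ltr01 ?inE ?eqxx ?orbT // xy normr0.
have [Q QQ [-> -> _]] := orthonormal_axes x1 y1 z1 xy xz yz.
exact: (orthogonal_copy [:: vec3 1 0 0; vec3 0 1 0] QQ).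
Qed.

Lemma three_rigid s : size s = 3 -> all_unit s -> coherence_le 0 s ->
  regular_octahedron (plus_minus s) /\ exists x y,
    [/\ x \in plus_minus s, y \in plus_minus s, x != y & 0 <= dot x y].
Proof.
case: s => [|x [|y [|z [|]]]] // _ /and4P[/eqP x1 /eqP y1 /eqP z1 _].
rewrite /coherence_le /= !andbT => /andP[/andP[]].
move=> /normr_le0_eq0 xy /normr_le0_eq0 xz /normr_le0_eq0 yz.
split; last first.
  by apply: (@sharp_pair _ _ x y); rewrite ?ltr01 ?inE ?eqxx ?orbT // xy normr0.
have [Q QQ ->] := orthonormal_axes x1 y1 z1 xy xz yz.
exact: orthogonal_copy.
Qed.

(** * The cube *)

(** Representatives of the four diagonals of the cube, with signs such that all
    inner products are equal to -1/3. *)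
Definition tetrahedron : seq 'rV[R]_3 := [seq (Num.sqrt 3)^-1 *: x | x <-
  [:: vec3 1 1 1; vec3 (-1) (-1) 1; vec3 (-1) 1 (-1); vec3 1 (-1) (-1)]].

Lemma std_cube_tetrahedron : std_cube = plus_minus tetrahedron.
Proof.
rewrite /std_cube /tetrahedron /=.
do ?[apply: plus_minus_flip; [by left | ] |
     apply: plus_minus_flip; [by right; rewrite -scalerN vec3N !opprK | ]].
by [].
Qed.

Lemma tetrahedron_gram (i j : 'I_4) :
  dot tetrahedron`_i tetrahedron`_j = if i == j then 1 else - (1 / 3).
Proof.
have k3 : (Num.sqrt 3 : R)^-1 * (Num.sqrt 3)^-1 = 1 / 3.
  by rewrite -expr2 exprVn sqr_sqrtr ?div1r ?ler0n.
by move: i j => -[[|[|[|[|//]]]] ?] -[[|[|[|[|//]]]] ?] /=;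
  rewrite dotZl dotZr dot_vec3 mulrA k3; field.
Qed.

Lemma tetrahedron_unit : all_unit tetrahedron.
Proof.
apply/(all_nthP 0) => i lt; apply/eqP.
by rewrite (tetrahedron_gram (Ordinal lt) (Ordinal lt)) eqxx.
Qed.

Lemma tetrahedron_coherence : coherence_le (1 / 3) tetrahedron.
Proof.
apply/(pairwiseP 0) => i j ilt jlt ij.
rewrite (tetrahedron_gram (Ordinal ilt) (Ordinal jlt)) -val_eqE /= ltn_eqF //.
by rewrite normrN ger0_norm // divr_ge0.
Qed.

Lemma sgr_scale (a : R) x : a *: x = `|a| *: (Num.sg a *: x).
Proof. by rewrite scalerA mulrC -numEsg. Qed.

Lemma sgr_flip (a : R) x : a != 0 -> Num.sg a *: x = x \/ Num.sg a *: x = - x.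
Proof.
rewrite neq_lt => /orP[] a0; [right; rewrite ltr0_sg // scaleN1r | left].
  by [].
by rewrite gtr0_sg // scale1r.
Qed.

Lemma coherence_flip c x y x' y' : x = x' \/ x = - x' -> y = y' \/ y = - y' ->
  `|dot x' y'| <= c -> `|dot x y| <= c.
Proof. by case=> ->; case=> ->; rewrite ?dotNl ?dotNr ?normrN. Qed.

Lemma dotxx_flip x x' : x = x' \/ x = - x' -> dot x x = dot x' x'.
Proof. by case=> ->; rewrite // dotNl dotNr opprK. Qed.

(** After changes of sign the four vectors satisfy a relation with positive
    coefficients, so the comparison applies with a single relation. *)
Lemma four_rigid s : size s = 4 -> all_unit s -> coherence_le (1 / 3) s ->
  cube (plus_minus s) /\ exists x y,
    [/\ x \in plus_minus s, y \in plus_minus s, x != y & 1 / 3 <= dot x y].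
Proof.
case: s => [|x1 [|x2 [|x3 [|x4 [|]]]]] // _ us cs.
have c2 : 1 / 3 < 1 / 2 :> R by lra.
have [b1 [b2 [b3 [b4 [[b10 b20 b30 b40] b0]]]]] := circuit c2 us cs.
have f1 := sgr_flip x1 b10; have f2 := sgr_flip x2 b20.
have f3 := sgr_flip x3 b30; have f4 := sgr_flip x4 b40.
rewrite (sgr_scale b1 x1) (sgr_scale b2 x2) (sgr_scale b3 x3) (sgr_scale b4 x4) in b0.
move: us cs.
move=> /and5P[/eqP u1 /eqP u2 /eqP u3 /eqP u4 _].
rewrite /coherence_le /= !andbT => /and3P[/and3P[c12 c13 c14] /andP[c23 c24] c34].
pose y := [:: Num.sg b1 *: x1; Num.sg b2 *: x2; Num.sg b3 *: x3; Num.sg b4 *: x4].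
have <- : plus_minus y = plus_minus [:: x1; x2; x3; x4].
  by do 4! apply: plus_minus_flip => //.
have gram : forall i j : 'I_4, dot y`_i y`_j = dot tetrahedron`_i tetrahedron`_j.
  apply: (@gram_rigid _ _ (1 / 3) (fun i : 'I_4 => y`_i) (fun i : 'I_4 => tetrahedron`_i)
    (fun i : 'I_4 => [:: `|b1|; `|b2|; `|b3|; `|b4|]`_i) (fun=> 0) 0) => //.
  - move=> i; rewrite tetrahedron_gram eqxx.
    by case: i => -[|[|[|[|//]]]] ? /=; rewrite (dotxx_flip f1, dotxx_flip f2, dotxx_flip f3, dotxx_flip f4).
  - by move=> -[[|[|[|[|//]]]] ?] -[[|[|[|[|//]]]] ?] //= _; apply: coherence_flip; eassumption.
  - by rewrite !big_ord_recl big_ord0 /= addr0 !addrA.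
  - by rewrite big1 // => i _; rewrite scale0r.
  - move=> i j ij; left; rewrite mul0r addr0 tetrahedron_gram -val_eqE /= ltn_eqF //.
    split=> //; apply: mulr_gt0.
      by case: i {ij} => -[|[|[|[|//]]]] ? /=; rewrite normr_gt0.
    by case: j {ij} => -[|[|[|[|//]]]] ? /=; rewrite normr_gt0.
split; last first.
  apply: (@sharp_pair _ _ y`_0 y`_1); rewrite ?mem_nth //; first by lra.
    by rewrite (dotxx_flip f1).
  rewrite (gram ord0 (lift ord0 ord0)) tetrahedron_gram /= normrN ger0_norm //.
  by rewrite divr_ge0.
have [|||Q QQ ->] := congruent_lists (n := 4) _ _ gram => //.
  by move=> v; apply: spanning_prefix c2 tetrahedron_unit tetrahedron_coherence _.
by rewrite /cube std_cube_tetrahedron; apply: orthogonal_copy.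
Qed.

End Shapes.

(** * The diagonals of the icosahedron *)

Section Icosahedron.
Context {R : realType}.
Implicit Types (x y z v : 'rV[R]_3) (c : R) (s e : seq 'rV[R]_3).

Definition ico_scale : R := (Num.sqrt (1 + golden ^+ 2))^-1.

(** Five of the six diagonals of the icosahedron, ordered and oriented so that
    their inner products have the signs which the comparison produces for five
    vectors in [pentad_rigid]. *)
Definition pentad : seq 'rV[R]_3 := [seq ico_scale *: x | x <-
  [:: vec3 1 golden 0; vec3 (- golden) 0 (-1); vec3 0 (-1) golden;
      vec3 golden 0 (-1); vec3 (-1) golden 0]].

Definition apex : 'rV[R]_3 := ico_scale *: vec3 0 1 golden.

Lemma std_icosahedron_pentad : std_icosahedron = plus_minus (apex :: pentad).
Proof.
pose g : R := golden.
transitivity (plus_minus [seq ico_scale *: x | x <-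
  [:: vec3 0 1 g; vec3 1 g 0; vec3 g 0 1; vec3 0 (-1) g; vec3 g 0 (-1);
      vec3 (-1) g 0]]).
  by apply: eq_plus_minus => v; rewrite !inE; do 6? [case: (v == _)].
rewrite /pentad /apex /=.
do ?[apply: plus_minus_flip; [by left | ] |
     apply: plus_minus_flip; [by right; rewrite -scalerN vec3N !opprK ?oppr0 | ]].
by [].
Qed.

Local Notation cosa := (1 / Num.sqrt 5 : R).

Lemma cosa_sqr : cosa ^+ 2 = 1 / 5.
Proof. by rewrite expr_div_n sqr_sqrtr ?ler0n // expr1n. Qed.

Lemma cosa_gt0 : 0 < cosa.
Proof. by rewrite divr_gt0 // sqrtr_gt0 ltr0n. Qed.

Lemma cosa_lt_half : cosa < 1 / 2.
Proof. by have := cosa_gt0; have := cosa_sqr; nra. Qed.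

Lemma ico_scale_sqr : ico_scale * ico_scale * (1 + golden * golden) = 1.
Proof.
have g0 : 0 < 1 + golden ^+ 2 :> R by rewrite ltr_pwDl ?sqr_ge0.
rewrite -!expr2 exprVn sqr_sqrtr ?mulVf ?gt_eqF //; exact: ltW.
Qed.

Lemma golden_sqr : golden * golden = golden + 1 :> R.
Proof.
have r5 : Num.sqrt 5 * Num.sqrt 5 = 5 :> R by rewrite -expr2 sqr_sqrtr ?ler0n.
by rewrite /golden; move: (Num.sqrt 5) r5 => r r5; field: r5.
Qed.

Lemma ico_scale_golden : ico_scale * ico_scale * golden = cosa.
Proof.
have r5 : Num.sqrt 5 * Num.sqrt 5 = 5 :> R by rewrite -expr2 sqr_sqrtr ?ler0n.
have r0 : Num.sqrt 5 != 0 :> R by rewrite gt_eqF // sqrtr_gt0 ltr0n.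
have gr : golden * Num.sqrt 5 = 1 + golden * golden :> R.
  by rewrite golden_sqr /golden mulrDl; move: (Num.sqrt 5) r5 => r r5; lra.
by apply: (mulIf r0); rewrite /= -(mulrA _ golden) gr ico_scale_sqr divfK.
Qed.

Lemma ico_dot (a b k a' b' k' : R) :
  dot (ico_scale *: vec3 a b k) (ico_scale *: vec3 a' b' k') =
  ico_scale * ico_scale * (a * a' + b * b' + k * k').
Proof. by rewrite !dotE dot_vec3 mulrA. Qed.

Lemma pentad_unit : all_unit pentad.
Proof.
have := ico_scale_sqr => k1.
rewrite /all_unit /pentad /= !ico_dot andbT.
by apply/and5P; split; apply/eqP; rewrite -[RHS]k1; ring.
Qed.

Lemma apex_unit : dot apex apex = 1.
Proof. by rewrite ico_dot -[RHS]ico_scale_sqr; ring. Qed.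

Definition pentad_pos (i j : nat) := (i, j) \in [:: (0, 3); (0, 4); (1, 4)]%N.

Lemma pentad_gram (i j : 'I_5) : (i < j)%N ->
  dot pentad`_i pentad`_j = if pentad_pos i j then cosa else - cosa.
Proof.
have := golden_sqr; have := ico_scale_golden; rewrite /pentad => k1 k2.
move: i j => -[[|[|[|[|[|//]]]]] ?] -[[|[|[|[|[|//]]]]] ?] //= _;
rewrite ico_dot -k1 ?(mulr0, mul0r, addr0, add0r, mulr1, mul1r, mulrN, mulNr, mulrN1, mulN1r, k2) //; ring.
Qed.

Lemma apex_pentad : all (fun w => `|dot apex w| <= cosa) pentad.
Proof.
have := golden_sqr; have := ico_scale_golden => k1 k2.
have cN : - cosa <= cosa by rewrite ge0_cp // ltW ?cosa_gt0.
apply/allP => w; rewrite !inE => w_in.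
have [->|->] : dot apex w = cosa \/ dot apex w = - cosa.
  case/or4P: w_in => [/eqP->|/eqP->|/eqP->|/orP[]/eqP->]; rewrite ico_dot -k1;
    rewrite !(mulr0, mul0r, addr0, add0r, mulr1, mul1r, mulrN, mulNr, mulrN1, mulN1r, k2);
    (by left; ring) || (by right; ring).
- by rewrite ger0_norm // ltW ?cosa_gt0.
- by rewrite normrN ger0_norm // ltW ?cosa_gt0.
Qed.

(** The six diagonals of the icosahedron form a tight frame: the sum of their
    orthogonal projections is invariant under the icosahedral group, hence a
    multiple of the identity, and its trace is 6. *)
Lemma ico_frame v :
  \sum_(w <- apex :: pentad) dot v w ^+ 2 = 2 * dot v v.
Proof.
have k1 := ico_scale_sqr.
have v3 : v = vec3 (v 0 0) (v 0 1) (v 0 2).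
  by apply/rowP => -[[|[|[|//]]] ?]; rewrite mxE /=; congr (v _ _); apply: val_inj.
rewrite v3 /pentad /apex /= !big_cons big_nil !dotZr !dot_vec3.
rewrite -[RHS]mulr1 -[X in _ = _ * X]k1; ring.
Qed.

End Icosahedron.

(** * Five lines *)

Section Five.
Context {R : realType}.
Implicit Types (x y z v : 'rV[R]_3) (c : R) (s e : seq 'rV[R]_3).
Local Notation cosa := (1 / Num.sqrt 5 : R).

Lemma between_max (u v w : R) : u < w -> v < w -> exists h, [/\ u < h, v < h & h < w].
Proof.
by move=> uw vw; case: (leP u v) => uv; [exists ((v + w) / 2)|exists ((u + w) / 2)];
  split; lra.
Qed.

Lemma pentad_unitE (i : 'I_5) : dot pentad`_i pentad`_i = 1 :> R.
Proof. by have /(all_nthP 0)/(_ i (ltn_ord i))/eqP := @pentad_unit R. Qed.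

Lemma pentad_coherence : coherence_le cosa pentad.
Proof.
apply/(pairwiseP 0) => i j ilt jlt ij.
rewrite (pentad_gram (i := Ordinal ilt) (j := Ordinal jlt)) //.
by case: ifP => _; rewrite ?normrN ger0_norm // ltW ?cosa_gt0.
Qed.

(** To y_0, ..., y_4 the relations attach the lines of slopes infinity,
    t_1 < t_2 < t_3 < t_4.  The quadratic form (t - m)(t' - m) + h on the dual
    plane makes the infinite slope perpendicular to m and the slope t
    perpendicular to m - h / (t - m).  Taking m between t_2 and t_3, and h below
    (m - t_1)(t_4 - m) but above the other three products (m - t_i)(t_j - m)
    with i in {1, 2} and j in {3, 4}, makes the line of slope infinity
    positively related to t_1, t_2 and negatively to t_3, t_4, and makes
    (1, 4) the only remaining pair with p_ij negative. *)
Lemma pentad_rigid (y : seq 'rV[R]_3) (w1 w2 w3 w4 t1 t2 t3 t4 : R) :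
  size y = 5 -> all_unit y -> coherence_le cosa y ->
  0 < w1 -> 0 < w2 -> 0 < w3 -> 0 < w4 -> t1 < t2 -> t2 < t3 -> t3 < t4 ->
  w1 *: y`_1 + w2 *: y`_2 + w3 *: y`_3 + w4 *: y`_4 = 0 ->
  (t1 * w1) *: y`_1 + (t2 * w2) *: y`_2 + (t3 * w3) *: y`_3 + (t4 * w4) *: y`_4
    = y`_0 ->
  forall i j : 'I_5, dot y`_i y`_j = dot pentad`_i pentad`_j.
Proof.
case: y => [|y0 [|y1 [|y2 [|y3 [|y4 [|]]]]]] // sy uy cy w10 w20 w30 w40 t12 t23 t34 /= sw stw.
(* Any m strictly between t2 and t3 would do. *)
pose m := (t2 + t3) / 2.
have m2 : t2 < m by rewrite /m; lra.
have m3 : m < t3 by rewrite /m; lra.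
have [||h [h13 h24 h14]] := @between_max ((m - t1) * (t3 - m)) ((m - t2) * (t4 - m))
  ((m - t1) * (t4 - m)).
- by rewrite ltr_pM2l; lra.
- by rewrite ltr_pM2r; lra.
have h0 : 0 < h by apply: lt_trans h13; apply: mulr_gt0; lra.
have h23 : (m - t2) * (t3 - m) < h.
  by apply: lt_trans h13; rewrite ltr_pM2r; lra.
apply: (@gram_rigid _ _ cosa (fun i : 'I_5 => [:: y0; y1; y2; y3; y4]`_i) (fun i : 'I_5 => pentad`_i)
  (fun i : 'I_5 => [:: -1; (t1 - m) * w1; (t2 - m) * w2; (t3 - m) * w3; (t4 - m) * w4]`_i)
  (fun i : 'I_5 => [:: 0; w1; w2; w3; w4]`_i) h) => //.
- exact: ltW.
- move=> i; rewrite pentad_unitE; apply/eqP.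
  by have /(all_nthP 0)/(_ i) := uy; apply.
- by move=> i j ij; move/(pairwiseP 0): cy; apply; rewrite ?inE ?ltn_ord.
- rewrite !big_ord_recl big_ord0 /= addr0 -stw.
  apply/rowP => i; have /rowP/(_ i) := sw; rewrite !mxE => swi.
  by rewrite -[RHS](mulr0 (- m)) -swi; ring.
- rewrite !big_ord_recl big_ord0 /= -[RHS]sw scale0r add0r addr0 !addrA //.
- move=> i j ij; rewrite pentad_gram //.
  case: i j ij => -[|[|[|[|[|//]]]]] ? -[[|[|[|[|[|//]]]]] ?] //= _.
  + by left; split=> //; nra.
  + by left; split=> //; nra.
  + by right; split=> //; nra.
  + by right; split=> //; nra.
  all: have q (a b u v : R) : a * u * (b * v) + h * (u * v) = (h + a * b) * (u * v) by ring.
  all: rewrite q.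
  + by left; split=> //; apply: mulr_gt0; [nra | exact: mulr_gt0].
  + by left; split=> //; apply: mulr_gt0; [nra | exact: mulr_gt0].
  + by right; split=> //; rewrite pmulr_llt0 ?mulr_gt0 //; nra.
  + by left; split=> //; apply: mulr_gt0; [nra | exact: mulr_gt0].
  + by left; split=> //; apply: mulr_gt0; [nra | exact: mulr_gt0].
  + by left; split=> //; apply: mulr_gt0; [nra | exact: mulr_gt0].
Qed.

(** Equal slopes allow two vectors to be eliminated at once between the two
    relations, which leaves a nontrivial relation between three vectors. *)
Lemma slope_neq c x u v p q (bu bv bp bq tu tv tp tq : R) : c < 1 / 2 ->
  dot x x = 1 -> dot p p = 1 -> dot q q = 1 ->
  `|dot x p| <= c -> `|dot x q| <= c -> `|dot p q| <= c ->
  bu *: u + bv *: v + bp *: p + bq *: q = 0 ->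
  (tu * bu) *: u + (tv * bv) *: v + (tp * bp) *: p + (tq * bq) *: q = x ->
  tu != tv.
Proof.
move=> c2 x1 p1 q1 xp xq pq sb stb; apply/eqP => tuv.
have : (-1) *: x + ((tp - tu) * bp) *: p + ((tq - tu) * bq) *: q = 0.
  rewrite -stb -tuv; apply/rowP => i; have /rowP/(_ i) := sb; rewrite !mxE => sbi.
  by rewrite -[RHS](mulr0 (- tu)) -sbi; ring.
case/(three_independent c2 x1 p1 q1 xp xq pq) => /eqP.
by rewrite oppr_eq0 oner_eq0.
Qed.

End Five.

Section FiveSix.
Context {R : realType}.
Implicit Types (x y z v : 'rV[R]_3) (c : R) (s e : seq 'rV[R]_3).
Local Notation cosa := (1 / Num.sqrt 5 : R).

(** The relation between x_1, ..., x_4 provides the weights b_i, and an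
    expression of x_0 in x_1, x_2, x_3 the slopes t_i = a_i / b_i, with
    t_4 = 0.  The slopes are distinct; sorting the vectors by slope and changing
    the signs of those with b_i < 0 gives the hypotheses of [pentad_rigid]. *)
Lemma five_gram s : size s = 5 -> all_unit s -> coherence_le cosa s ->
  exists y : seq 'rV[R]_3, [/\ size y = 5, plus_minus y = plus_minus s &
    forall i j : 'I_5, dot y`_i y`_j = dot pentad`_i pentad`_j].
Proof.
have c2 := @cosa_lt_half R.
case: s => [|x0 [|x1 [|x2 [|x3 [|x4 [|]]]]]] // _ us cs.
have us4 : all_unit [:: x1; x2; x3; x4] by case/andP: us.
have cs4 : coherence_le cosa [:: x1; x2; x3; x4] by case/andP: cs.
have [b1 [b2 [b3 [b4 [[b10 b20 b30 b40] sb]]]]] := circuit c2 us4 cs4.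
have us3 : all_unit [:: x1; x2; x3].
  by case/and5P: us4 => u1 u2 u3 _ _; apply/and4P.
have cs3 := subseq_pairwise (prefix_subseq [:: x1; x2; x3] [:: x4]) cs4.
have [a1 [a2 [a3 x0E]]] := decompose x0 c2 us3 cs3.
have {x0E} : (a1 / b1 * b1) *: x1 + (a2 / b2 * b2) *: x2 + (a3 / b3 * b3) *: x3 +
  (0 * b4) *: x4 = x0 by rewrite !divfK // mul0r scale0r addr0.
move: (a1 / b1) (a2 / b2) (a3 / b3) (0 : R) => t1 t2 t3 t4 stb.
clear a1 a2 a3 us3 cs3 cs4 us4.
have {us} /and5P[/eqP u0 /eqP u1 /eqP u2 /eqP u3 /andP[/eqP u4 _]] := us.
have {cs} := cs; rewrite /coherence_le /= !andbT.
case/and4P=> /and4P[c01 c02 c03 c04] /and3P[c12 c13 c14] /andP[c23 c24] c34.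
(* Triples (slope, weight, vector), sorted below by their first component. *)
pose P := [:: (t1, b1, x1); (t2, b2, x2); (t3, b3, x3); (t4, b4, x4)].
have uP : uniq [seq p.1.1 | p <- P].
  have neq12 : t1 != t2 by exact: (slope_neq c2 u0 u3 u4 c03 c04 c34 sb stb).
  have neq13 : t1 != t3.
    apply: (slope_neq (u := x1) (v := x3) c2 u0 u2 u4 c02 c04 c24).
      by rewrite -[RHS]sb [LHS](ACl (1*3*2*4)).
    by rewrite -[RHS]stb [LHS](ACl (1*3*2*4)).
  have neq14 : t1 != t4.
    apply: (slope_neq (u := x1) (v := x4) c2 u0 u2 u3 c02 c03 c23).
      by rewrite -[RHS]sb [LHS](ACl (1*3*4*2)).
    by rewrite -[RHS]stb [LHS](ACl (1*3*4*2)).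
  have neq23 : t2 != t3.
    apply: (slope_neq (u := x2) (v := x3) c2 u0 u1 u4 c01 c04 c14).
      by rewrite -[RHS]sb [LHS](ACl (3*1*2*4)).
    by rewrite -[RHS]stb [LHS](ACl (3*1*2*4)).
  have neq24 : t2 != t4.
    apply: (slope_neq (u := x2) (v := x4) c2 u0 u1 u3 c01 c03 c13).
      by rewrite -[RHS]sb [LHS](ACl (3*1*4*2)).
    by rewrite -[RHS]stb [LHS](ACl (3*1*4*2)).
  have neq34 : t3 != t4.
    apply: (slope_neq (u := x3) (v := x4) c2 u0 u1 u2 c01 c02 c12).
      by rewrite -[RHS]sb [LHS](ACl (3*4*1*2)).
    by rewrite -[RHS]stb [LHS](ACl (3*4*1*2)).
  by rewrite /= !inE !negb_or neq12 neq13 neq14 neq23 neq24 neq34.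
have sumP (f : R * R * 'rV[R]_3 -> 'rV[R]_3) :
    \sum_(p <- P) f p = f (t1, b1, x1) + f (t2, b2, x2) + f (t3, b3, x3) + f (t4, b4, x4).
  by rewrite !big_cons big_nil addr0 !addrA.
have sbP : \sum_(p <- P) p.1.2 *: p.2 = 0 by rewrite sumP.
have stbP : \sum_(p <- P) (p.1.1 * p.1.2) *: p.2 = x0 by rewrite sumP.
have goodP : all (fun p => [&& p.1.2 != 0, dot p.2 p.2 == 1 & `|dot x0 p.2| <= cosa]) P.
  by rewrite /= b10 b20 b30 b40 u1 u2 u3 u4 c01 c02 c03 c04 !eqxx.
have cohP : {in P &, forall p q, p.1.1 != q.1.1 -> `|dot p.2 q.2| <= cosa}.
  by move=> p q; rewrite !inE => /or4P[] /eqP -> /or4P[] /eqP -> //=;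
     rewrite ?eqxx // dotC.
have xP : [:: x1; x2; x3; x4] = [seq p.2 | p <- P] by [].
have [P' PP' srt] : exists2 P', perm_eq P' P & sorted <%O [seq p.1.1 | p <- P'].
  exists (sort (relpre (fun p => p.1.1) <=%O) P); first exact: permEl (perm_sort _ _).
  rewrite lt_sorted_uniq_le (perm_uniq (perm_map _ (permEl (perm_sort _ _)))) uP /=.
  by rewrite sorted_map; apply: sort_sorted => p q; exact: le_total.
rewrite -(perm_big _ PP') in sbP; rewrite -(perm_big _ PP') in stbP.
rewrite -(perm_all _ PP') in goodP.
have {}cohP : {in P' &, forall p q, p.1.1 != q.1.1 -> `|dot p.2 q.2| <= cosa}.
  by move=> p q; rewrite !(perm_mem PP'); exact: cohP.
have P'x : plus_minus (x0 :: [seq p.2 | p <- P']) = plus_minus [:: x0; x1; x2; x3; x4].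
  by apply: eq_plus_minus => v; rewrite xP !in_cons (perm_mem (perm_map _ PP')).
have sP' : size P' = 4 by rewrite (perm_size PP').
rewrite -P'x; move: P' {PP' P'x} sP' srt sbP stbP goodP cohP.
move=> [|[[s1 w1] z1] [|[[s2 w2] z2] [|[[s3 w3] z3] [|[[s4 w4] z4] [|]]]]] //= _.
move=> /and4P[s12 s23 s34 _]; rewrite !big_cons !big_nil !addr0 !addrA /=.
move=> {}sb {}stb; rewrite andbT => /and4P[].
move=> /and3P[w10 /eqP v1 d1] /and3P[w20 /eqP v2 d2].
move=> /and3P[w30 /eqP v3 d3] /and3P[w40 /eqP v4 d4] coh.
have f0 : x0 = x0 \/ x0 = - x0 by left.
have f1 := sgr_flip z1 w10; have f2 := sgr_flip z2 w20.
have f3 := sgr_flip z3 w30; have f4 := sgr_flip z4 w40.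
exists [:: x0; Num.sg w1 *: z1; Num.sg w2 *: z2; Num.sg w3 *: z3; Num.sg w4 *: z4].
split=> //; first by do 5! apply: plus_minus_flip => //.
apply: (pentad_rigid (w1 := `|w1|) (w2 := `|w2|) (w3 := `|w3|) (w4 := `|w4|)
  _ _ _ _ _ _ _ s12 s23 s34); rewrite ?normr_gt0 //=.
- by rewrite (dotxx_flip f1) (dotxx_flip f2) (dotxx_flip f3) (dotxx_flip f4)
    u0 v1 v2 v3 v4 !eqxx.
- rewrite /coherence_le /= (coherence_flip f0 f1) // (coherence_flip f0 f2) //.
  rewrite (coherence_flip f0 f3) // (coherence_flip f0 f4) //.
  have lt13 := lt_trans s12 s23; have lt24 := lt_trans s23 s34.
  have lt14 := lt_trans s12 lt24.
  rewrite (coherence_flip f1 f2) ?(coherence_flip f1 f3) ?(coherence_flip f1 f4) //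
    ?(coherence_flip f2 f3) ?(coherence_flip f2 f4) ?(coherence_flip f3 f4) //.
  + by apply: (coh (s3, w3, z3) (s4, w4, z4)); rewrite ?inE ?eqxx ?orbT ?lt_eqF.
  + by apply: (coh (s2, w2, z2) (s4, w4, z4)); rewrite ?inE ?eqxx ?orbT ?lt_eqF.
  + by apply: (coh (s2, w2, z2) (s3, w3, z3)); rewrite ?inE ?eqxx ?orbT ?lt_eqF.
  + by apply: (coh (s1, w1, z1) (s4, w4, z4)); rewrite ?inE ?eqxx ?orbT ?lt_eqF.
  + by apply: (coh (s1, w1, z1) (s3, w3, z3)); rewrite ?inE ?eqxx ?orbT ?lt_eqF.
  + by apply: (coh (s1, w1, z1) (s2, w2, z2)); rewrite ?inE ?eqxx ?orbT ?lt_eqF.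
- by rewrite -!sgr_scale.
- by rewrite -[RHS]stb -!scalerA -!sgr_scale.
Qed.

Lemma five_orthogonal s : size s = 5 -> all_unit s -> coherence_le cosa s ->
  exists2 Q : 'M[R]_3, Q *m Q^T = 1%:M &
    plus_minus s = plus_minus [seq v *m Q | v <- pentad].
Proof.
move=> ss us cs; have [y [sy <- gram]] := five_gram ss us cs.
have [|| Q QQ ->] := congruent_lists sy _ gram => //; last by exists Q.
by move=> v; apply: spanning_prefix cosa_lt_half pentad_unit pentad_coherence _.
Qed.

Lemma dot_orthogonal (Q : 'M[R]_3) x y : Q *m Q^T = 1%:M ->
  dot (x *m Q) (y *m Q) = dot x y.
Proof.
by move=> QQ; rewrite !dot_mulmx trmx_mul mulmxA -(mulmxA x) QQ mulmx1.
Qed.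

Lemma pentad_sharp (Q : 'M[R]_3) : Q *m Q^T = 1%:M ->
  let X := plus_minus [seq v *m Q | v <- pentad] in
  exists x y, [/\ x \in X, y \in X, x != y & cosa <= dot x y].
Proof.
move=> QQ; apply: (@sharp_pair _ _ _ (pentad`_0 *m Q) (pentad`_1 *m Q)).
- by have := @cosa_lt_half R; lra.
- by apply: (map_f (fun v => v *m Q)); apply: mem_nth.
- by apply: (map_f (fun v => v *m Q)); apply: mem_nth.
- by rewrite dot_orthogonal // (pentad_unitE ord0).
- rewrite dot_orthogonal // (@pentad_gram R ord0 (lift ord0 ord0)) //=.
  by rewrite normrN ger0_norm // ltW ?cosa_gt0.
Qed.

Lemma five_rigid s : size s = 5 -> all_unit s -> coherence_le cosa s ->
  five_antipodal_pairs_of_icosahedron (plus_minus s) /\ exists x y,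
    [/\ x \in plus_minus s, y \in plus_minus s, x != y & cosa <= dot x y].
Proof.
move=> ss us cs; have [Q QQ sQ] := five_orthogonal ss us cs.
split; last by rewrite sQ; apply: pentad_sharp.
exists (plus_minus [seq v *m Q | v <- apex :: pentad]).
  by rewrite /regular_icosahedron std_icosahedron_pentad; apply: orthogonal_copy.
split.
- rewrite sQ; apply/fsubsetP => v; rewrite !mem_plus_minus /= !in_cons.
  by case/orP=> ->; rewrite !orbT.
- exact: antipodal_plus_minus.
- have c01 : 0 <= cosa < 1.
    by have := @cosa_lt_half R; have := @cosa_gt0 R => *; apply/andP; split; lra.
  by have [[_ _ ->] _] := plus_minus_config c01 us cs; rewrite ss.
Qed.

(** * Six lines *)

(** The frame identity leaves no room for a sixth line other than the remaining
    diagonal: its five squared cosines with the pentad sum to at most 1, so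
    its squared cosine with the apex is at least 1. *)
Lemma apex_rigid v : dot v v = 1 -> (forall w, w \in pentad -> `|dot v w| <= cosa) ->
  v = apex \/ v = - apex.
Proof.
move=> v1 vc; have := ico_frame v; rewrite big_cons v1 => frame.
have : \sum_(w <- pentad) dot v w ^+ 2 <= 1.
  apply: (@le_trans _ _ (\sum_(w <- @pentad R) 1 / 5)).
    rewrite !big_seq; apply: ler_sum => w w_in; rewrite -cosa_sqr -real_normK ?num_real //.
    by rewrite ler_sqr ?nnegrE ?vc // ltW ?cosa_gt0.
  by rewrite big_const_seq /= /pentad /=; lra.
move=> le1; have {frame le1} ge1 : 1 <= dot v apex ^+ 2 by lra.
case: (lerP 0 (dot v apex)) => va; [left | right].
  by apply: unit_eq; rewrite ?apex_unit //; nra.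
by apply: unit_eq; rewrite ?dotNl ?dotNr ?opprK ?apex_unit //; nra.
Qed.

Lemma six_rigid s : size s = 6 -> all_unit s -> coherence_le cosa s ->
  regular_icosahedron (plus_minus s) /\ exists x y,
    [/\ x \in plus_minus s, y \in plus_minus s, x != y & cosa <= dot x y].
Proof.
case: s => // x s [ss] /andP[/eqP x1 us] /andP[/allP xs cs].
have [Q QQ sQ] := five_orthogonal ss us cs.
have xQ : x *m Q^T *m Q = x by rewrite -mulmxA (mulmx1C QQ) mulmx1.
have xapex : x = apex *m Q \/ x = - (apex *m Q).
  case: (@apex_rigid (x *m Q^T)).
  - by rewrite -(dot_orthogonal _ _ QQ) xQ.
  - move=> w w_in; rewrite -(dot_orthogonal _ _ QQ) xQ.
    have : w *m Q \in plus_minus s.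
      rewrite sQ mem_plus_minus; apply/orP; left.
      exact: (map_f (fun v => v *m Q)).
    rewrite mem_plus_minus => /orP[] /xs //.
    by rewrite dotNr normrN.
  - by move=> <-; rewrite xQ; left.
  - by move=> /(congr1 (fun z => z *m Q)); rewrite xQ mulNmx => ->; right.
split.
  rewrite /regular_icosahedron std_icosahedron_pentad.
  have -> : plus_minus (x :: s) = plus_minus [seq v *m Q | v <- apex :: pentad].
    exact: plus_minus_flip.
  exact: orthogonal_copy.
have [y [z [yX zX yz c_yz]]] := pentad_sharp QQ; exists y, z.
split=> //; move: yX zX; rewrite -sQ !mem_plus_minus !in_cons.
  by move=> /orP[] ->; rewrite !orbT.
by move=> _ /orP[] ->; rewrite !orbT.
Qed.

End FiveSix.

Unset Implicit Arguments.

(** * The optimal configurations *)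

Theorem mainTheorem1 (R : realType) :
  [/\ (forall X : {fset 'rV[R]_3}, optimal 2 X -> great_circle_square X) /\
        is_max_psi 2 (pi / 2 : R),
      (forall X : {fset 'rV[R]_3}, optimal 3 X -> regular_octahedron X) /\
        is_max_psi 3 (pi / 2 : R),
      (forall X : {fset 'rV[R]_3}, optimal 4 X -> cube X) /\
        is_max_psi 4 (acos (1 / 3) : R),
      (forall X : {fset 'rV[R]_3},
         optimal 5 X -> five_antipodal_pairs_of_icosahedron X) /\
        is_max_psi 5 (acos (1 / Num.sqrt 5) : R) &
      (forall X : {fset 'rV[R]_3}, optimal 6 X -> regular_icosahedron X) /\
        is_max_psi 6 (acos (1 / Num.sqrt 5) : R)].
Proof.
have c01 : 0 <= (1 / Num.sqrt 5 : R) < 1.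
  by have := @cosa_lt_half R; have := @cosa_gt0 R => *; apply/andP; split; lra.
rewrite -acos0; split.
- apply: (@optimal_of_rigid _ _ _ _ (take 2 axes) _ _ _ _ two_rigid) => //.
  + by rewrite lexx ltr01.
  + by have /and4P[u1 u2 _ _] := @axes_unit R; apply/and3P.
  + exact: subseq_pairwise (take_subseq _ _) axes_coherence.
- apply: (optimal_of_rigid _ _ axes_unit axes_coherence three_rigid) => //.
  by rewrite lexx ltr01.
- apply: (optimal_of_rigid _ _ tetrahedron_unit tetrahedron_coherence four_rigid) => //.
  by lra.
- exact: (optimal_of_rigid c01 _ pentad_unit pentad_coherence five_rigid).
- apply: (@optimal_of_rigid _ _ _ _ (apex :: pentad) c01 _ _ _ six_rigid) => //.
    by rewrite /all_unit /= apex_unit eqxx; exact: pentad_unit.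
  by rewrite /coherence_le /=; apply/andP; split; [exact: apex_pentad | exact: pentad_coherence].
Qed.
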